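(* Let $ABC$ be a triangle with no two sides equal. When $P$ is the Gergonne point of $ABC$, the conic $\mathcal{C}_P = ABCPQ$ is the Feuerbach hyperbola $ABCHI$ on the orthocenter $H$ and the incenter $Q=I$. The Feuerbach hyperbola also passes through the Nagel point $P'$, the Mittenpunkt $Q'$, and the generalized orthocenter $H'$ of the Nagel point, which is the point of intersection of the lines through $A, B, C$ which are parallel to the respective lines joining the Mittenpunkt to the opposite points of external tangency of $ABC$ with its excircles (i.e. for the vertex $A$, the point where the $A$-excircle touches side $BC$, and similarly for $B$ and $C$).
   Context: $G$ is the centroid of $ABC$. $K$ is the complement map, the homothety with center $G$ and ratio $-1/2$. $P'$ is the isotomic conjugate of $P$ with respect to $ABC$ (in barycentric coordinates $(x:y:z)\mapsto(1/x:1/y:1/z)$), $Q=K(P')$ and $Q'=K(P)$. The Gergonne point is the intersection of the lines joining the vertices to the points of contact of the incircle with the opposite sides; the Nagel point is the intersection of the lines joining the vertices to the points of contact of the excircles with the opposite sides (it is the isotomic conjugate of the Gergonne point); the Mittenpunkt is the complement $K(P)$ of the Gergonne point $P$. $\mathcal{C}_P=ABCPQ$ is the unique conic through $A,B,C,P,Q$ (defined when $P$ is not on a median of $ABC$). The generalized orthocenter of a point $X$ (not on the extended sides of $ABC$ or of its anticomplementary triangle) with traces $X_A,X_B,X_C$ on $BC,CA,AB$ is the point common to the lines through $A,B,C$ parallel respectively to $YX_A,YX_B,YX_C$, where $Y$ is the complement (under $K$) of the isotomic conjugate of $X$. For $X=P$ the Gergonne point this is the ordinary orthocenter $H$. The Feuerbach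 hyperbola of $ABC$ is the rectangular hyperbola through $A,B,C$ and the incenter $I$; it passes through the orthocenter $H$, and when $ABC$ is not right-angled it is the unique conic through $A,B,C,H,I$. *)

(* Defs.v *)
From mathcomp Require Import all_boot all_order all_algebra.

Set Implicit Arguments.
Unset Strict Implicit.
Unset Printing Implicit Defensive.

Import Order.TTheory GRing.Theory Num.Theory.
Local Open Scope ring_scope.

Section EuclideanPlane.
Variable R : rcfType.
Implicit Types (A B C D E F O P T X Y : 'rV[R]_2) (u v : 'rV[R]_2).

(* The norm that MathComp-Analysis puts on row vectors is the sup norm, hence
   the explicit Euclidean distance. *)
Definition dot u v : R := \sum_i u 0 i * v 0 i.
Definition dist X Y : R := Num.sqrt (dot (Y - X) (Y - X)).
Definition cross u v : R := u 0 0 * v 0 1 - u 0 1 * v 0 0.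

(* [on_line X Y] is the line XY only when X != Y; it is always true if X = Y. *)
Definition on_line X Y T : bool := cross (Y - X) (T - X) == 0.
Definition on_segment X Y T : Prop :=
  exists2 t : R, 0 <= t <= 1 & T = X + t *: (Y - X).

Definition triangle A B C : bool := ~~ on_line A B C.
Definition scalene A B C : bool :=
  [&& dist A B != dist B C, dist B C != dist C A & dist C A != dist A B].
Definition right_angled A B C : bool :=
  [|| dot (B - A) (C - A) == 0, dot (C - B) (A - B) == 0
    | dot (A - C) (B - C) == 0].

Definition centroid A B C : 'rV[R]_2 := 3^-1 *: (A + B + C).
Definition complement A B C X : 'rV[R]_2 :=
  let G := centroid A B C in G + (- 2^-1) *: (X - G).

Definition barycentric A B C X (x y z : R) : Prop :=
  x + y + z != 0 /\ (x + y + z) *: X = x *: A + y *: B + z *: C.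

(* No [X'] is related to [X] when [X] lies on a side line, or when its
   isotomic conjugate is a point at infinity. *)
Definition isotomic A B C X X' : Prop :=
  exists x y z : R,
    [/\ [&& x != 0, y != 0 & z != 0],
        barycentric A B C X x y z
      & barycentric A B C X' x^-1 y^-1 z^-1].

Definition orthocenter A B C X : Prop :=
  [/\ dot (X - A) (C - B) = 0, dot (X - B) (A - C) = 0
    & dot (X - C) (B - A) = 0].

(* The circle with center O and radius r touches the line XY at T. *)
Definition tangent_at O (r : R) X Y T : Prop :=
  [/\ on_line X Y T, dot (T - O) (Y - X) = 0 & dist O T = r].

(* Among the four circles tangent to the side lines, the incircle is the one
   whose contact points D, E, F all lie on the sides themselves. *)
Definition incircle A B C O (r : R) D E F : Prop :=
  [/\ 0 < r,
      tangent_at O r B C D /\ on_segment B C D,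
      tangent_at O r C A E /\ on_segment C A E
    & tangent_at O r A B F /\ on_segment A B F].

(* The A-excircle touches the side BC, and the sides AC and AB extended
   beyond C and B respectively. *)
Definition excircle A B C O (r : R) D E F : Prop :=
  [/\ 0 < r,
      tangent_at O r B C D /\ on_segment B C D,
      tangent_at O r C A E /\ on_segment A E C
    & tangent_at O r A B F /\ on_segment A F B].

Definition incenter A B C X : Prop :=
  exists (r : R) D E F, incircle A B C X r D E F.

(* The point where the A-excircle touches the side BC. *)
Definition excontact A B C D : Prop :=
  exists O (r : R) E F, excircle A B C O r D E F.

Definition gergonne A B C P : Prop :=
  exists O (r : R) D E F, incircle A B C O r D E F /\
    [/\ on_line A D P, on_line B E P & on_line C F P].

Definition nagel A B C P : Prop :=
  exists D E F,
    [/\ excontact A B C D, excontact B C A E & excontact C A B F] /\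
    [/\ on_line A D P, on_line B E P & on_line C F P].

Definition mittenpunkt A B C X : Prop :=
  exists2 P, gergonne A B C P & X = complement A B C P.

(* T is the only point common to the lines through A, B, C parallel to
   YD, YE, YF respectively. *)
Definition meet_of_parallels A B C Y D E F T : Prop :=
  [/\ Y != D, Y != E, Y != F
    & forall S : 'rV[R]_2,
        [&& cross (D - Y) (S - A) == 0, cross (E - Y) (S - B) == 0
          & cross (F - Y) (S - C) == 0] = (S == T)].

(* The anticomplementary triangle, whose images under the complement map are
   the vertices A, B, C, has vertices B + C - A, C + A - B, A + B - C. *)
Definition off_sides A B C X : bool :=
  [&& ~~ on_line B C X, ~~ on_line C A X & ~~ on_line A B X].
Definition generic A B C X : bool :=
  off_sides A B C X && off_sides (B + C - A) (C + A - B) (A + B - C) X.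

Definition gen_orthocenter A B C X T : Prop :=
  generic A B C X /\
  exists X' D E F,
    [/\ isotomic A B C X X',
        on_line B C D && on_line A X D,
        on_line C A E && on_line B X E,
        on_line A B F && on_line C X F
      & meet_of_parallels A B C (complement A B C X') D E F T].

(* A conic is a nonzero symmetric matrix up to a scalar, acting on the
   homogeneous coordinates (x, y, w): affine points have w = 1, points at
   infinity have w = 0. *)
Implicit Types M N : 'M[R]_(2 + 1).

Definition conic M : Prop := M^T = M /\ M != 0.
Definition same_conic M N : Prop := exists2 l : R, l != 0 & N = l *: M.
Definition conic_form M X (w : R) : R :=
  let h := row_mx X (w%:M : 'M_1) in (h *m M *m h^T) 0 0.
Definition on_conic M X : bool := conic_form M X 1 == 0.
Definition at_infinity M u : bool := (u != 0) && (conic_form M u 0 == 0).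

(* The asymptotes of a hyperbola are its tangents at its two points at
   infinity, so these give their directions; perpendicular nonzero directions
   are automatically distinct. *)
Definition rectangular_hyperbola M : Prop :=
  [/\ conic M, \det M != 0
    & exists u v, [/\ at_infinity M u, at_infinity M v & dot u v = 0]].

Definition unique_conic_through (s : seq 'rV[R]_2) M : Prop :=
  [/\ conic M, all (on_conic M) s
    & forall N, conic N -> all (on_conic N) s -> same_conic M N].

Definition feuerbach_hyperbola A B C M : Prop :=
  exists I : 'rV[R]_2,
    [/\ incenter A B C I, rectangular_hyperbola M,
        all (on_conic M) [:: A; B; C; I]
      & forall N, rectangular_hyperbola N ->
          all (on_conic N) [:: A; B; C; I] -> same_conic M N].

End EuclideanPlane.

(* Main.v *)
(* Put x = s - a, y = s - b, z = s - c, where s is the semiperimeter, so that the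
   sides are a = y + z, b = z + x, c = x + y (Ravi substitution).  Equality of
   the tangent lengths from each vertex gives the points of contact, and then, in
   barycentric coordinates, the Gergonne point is (1/x : 1/y : 1/z), the Nagel
   point (x : y : z), the incenter (y + z : z + x : x + y) and the Mittenpunkt
   (x(y + z) : y(z + x) : z(x + y)).  A conic through A, B, C has an equation
   l YZ + m ZX + n XY = 0, so each further point is one linear condition on
   (l, m, n), and so is being rectangular, namely l Sa + m Sb + n Sc = 0 with
   Sa = AB.AC, Sb = BC.BA, Sc = CA.CB; away from right angles this says that the
   conic passes through the orthocenter (Sb Sc : Sc Sa : Sa Sb).  All these conditions hold for
   l = x(y + z)(z - y), m = y(z + x)(x - z), n = z(x + y)(y - x), and the two
   conditions in each uniqueness claim are independent because x, y, z are
   distinct.  With t = xy + yz + zx the generalized orthocenter of the Nagel point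
   is (x(t - y^2)(t - z^2) : y(t - z^2)(t - x^2) : z(t - x^2)(t - y^2)). *)
Require Import Defs.
From mathcomp Require Import all_boot all_order all_algebra.
From mathcomp Require Import ring lra.

Set Implicit Arguments.
Unset Strict Implicit.
Unset Printing Implicit Defensive.

Import Order.TTheory GRing.Theory Num.Theory.
Local Open Scope ring_scope.

(** * Dot and cross products in the Euclidean plane *)

Lemma dotE (R : rcfType) (u v : 'rV[R]_2) :
  dot u v = u 0 0 * v 0 0 + u 0 1 * v 0 1.
Proof.
rewrite /dot !big_ord_recl big_ord0 addr0.
by congr (_ * _ + u _ _ * v _ _); apply/val_inj.
Qed.

Lemma rV2P (R : rcfType) (u v : 'rV[R]_2) :
  u 0 0 = v 0 0 -> u 0 1 = v 0 1 -> u = v.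
Proof.
move=> h0 h1; apply/rowP=> i.
have [->|->] // : i = 0 \/ i = 1.
by case: i => [[|[|//]] ?]; [left|right]; apply/val_inj.
Qed.

Lemma dot_comb (R : rcfType) (p q : 'rV[R]_2) (a b c d : R) :
  dot (a *: p + b *: q) (c *: p + d *: q)
  = a * c * dot p p + (a * d + b * c) * dot p q + b * d * dot q q.
Proof. by rewrite !dotE !mxE; ring. Qed.

Lemma cross_comb (R : rcfType) (p q : 'rV[R]_2) (a b c d : R) :
  cross (a *: p + b *: q) (c *: p + d *: q) = (a * d - b * c) * cross p q.
Proof. by rewrite /cross !mxE; ring. Qed.

(** Cramer's rule. It identifies two points whose difference is perpendicular to two independent
    side directions. *)
Lemma perp_basis_eq0 (R : rcfType) (p q v : 'rV[R]_2) :
  cross p q != 0 -> dot v p = 0 -> dot v q = 0 -> v = 0.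
Proof.
move=> d0 hp hq; apply: rV2P; rewrite [RHS]mxE; apply: (mulfI d0).
  transitivity (dot v p * q 0 1 - dot v q * p 0 1); last by rewrite hp hq; ring.
  by rewrite !dotE /cross; ring.
transitivity (dot v q * p 0 0 - dot v p * q 0 0); last by rewrite hp hq; ring.
by rewrite !dotE /cross; ring.
Qed.

Lemma sqr_dist (R : rcfType) (X Y : 'rV[R]_2) :
  dist X Y ^+ 2 = dot (Y - X) (Y - X).
Proof. by rewrite /dist sqr_sqrtr // dotE -!expr2 addr_ge0 ?sqr_ge0. Qed.

Lemma distC (R : rcfType) (X Y : 'rV[R]_2) : dist X Y = dist Y X.
Proof. by congr Num.sqrt; rewrite !dotE !mxE; ring. Qed.

Lemma dist_ge0 (R : rcfType) (X Y : 'rV[R]_2) : 0 <= dist X Y.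
Proof. exact: sqrtr_ge0. Qed.

(** * Tangent lengths *)

Section Ravi.
Variable R : rcfType.
Implicit Types (A B C D E F O P T X Y : 'rV[R]_2) (a b c k r x y z : R).

(* Half the perimeter minus the side opposite to [A].  It is locked because
   [addr_gt0] would otherwise unfold it and split the positivity of the sum. *)
Definition ravi A B C : R := locked ((dist C A + dist A B - dist B C) / 2).

Lemma ravi_dist A B C : ravi A B C + ravi B C A = dist A B.
Proof. by rewrite /ravi -!lock; field. Qed.

Lemma triangleC A B C : triangle A B C = triangle B C A.
Proof.
rewrite /triangle /on_line; congr (~~ (_ == _)).
by rewrite /cross !mxE; ring.
Qed.

(** Heron's formula: [cross] is twice the signed area, and the three [ravi] values add up to the
    semiperimeter. *)
Lemma heron A B C :
  cross (B - A) (C - A) ^+ 2 = 4 * ravi A B C * ravi B C A * ravi C A B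
    * (ravi A B C + ravi B C A + ravi C A B).
Proof.
transitivity ((4 * dist A B ^+ 2 * dist C A ^+ 2
  - (dist A B ^+ 2 + dist C A ^+ 2 - dist B C ^+ 2) ^+ 2) / 4); last first.
  by rewrite /ravi -!lock; field.
by rewrite !sqr_dist !dotE /cross !mxE; field.
Qed.

(** If [x <= 0], the side lengths [x + y] and [z + x] force [y], [z] and [x + y + z] to be
    nonnegative, so Heron's product is at most 0; but it is a nonzero square. *)
Lemma ravi_gt0 A B C : triangle A B C -> 0 < ravi A B C.
Proof.
rewrite /triangle /on_line -sqrf_eq0 heron => h.
have := sqr_ge0 (cross (B - A) (C - A)); rewrite heron le0r (negPf h) /=.
have := dist_ge0 A B; have := dist_ge0 C A; rewrite -(ravi_dist A B C) -(ravi_dist C A B).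
move: h; set x := ravi A B C; set y := ravi B C A; set z := ravi C A B.
move=> h b0 c0 pos.
have [//|x0] := ltP 0 x.
have y0 : 0 <= y by lra.
have z0 : 0 <= z by lra.
have s0 : 0 <= y * z by apply: mulr_ge0.
have s1 : 0 <= y * z * (x + y + z) by apply: mulr_ge0 => //; lra.
have := mulr_le0_ge0 x0 s1; nra.
Qed.

(** The law of cosines, with sides written as sums of tangent lengths. *)
Lemma dot_ravi A B C :
  dot (B - A) (C - A)
  = (ravi A B C) ^+ 2 + ravi A B C * ravi B C A + ravi A B C * ravi C A B
    - ravi B C A * ravi C A B.
Proof.
transitivity ((dist A B ^+ 2 + dist C A ^+ 2 - dist B C ^+ 2) / 2).
  by rewrite !sqr_dist !dotE !mxE; field.
by rewrite /ravi -!lock; field.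
Qed.

(** Pythagoras: the squared tangent length from an endpoint is its power with respect to the circle,
    so it is the same for both tangents from a vertex. *)
Lemma tangent_length O r X Y T k :
  T = X + k *: (Y - X) -> dot (T - O) (Y - X) = 0 -> dist O T = r ->
  (k * dist X Y) ^+ 2 = dot (O - X) (O - X) - r ^+ 2
  /\ ((1 - k) * dist X Y) ^+ 2 = dot (O - Y) (O - Y) - r ^+ 2.
Proof.
move=> -> + <-; rewrite !exprMn !sqr_dist !dotE !mxE => h.
split; first by move: (congr1 ( *%R (2 * k)) h); rewrite mulr0; lra.
by move: (congr1 ( *%R (2 * (k - 1))) h); rewrite mulr0; lra.
Qed.

Lemma sqr_inj a b c : 0 <= a -> 0 <= b -> a ^+ 2 = c -> b ^+ 2 = c -> a = b.
Proof. by move=> a0 b0 <- /eqP; rewrite eqrXn2 // => /eqP. Qed.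

(** Contact points on the sides make the tangent lengths nonnegative, so equal squares give equal
    lengths at each vertex; a linear system remains. *)
Lemma incircle_contact A B C O r D E F :
  triangle A B C -> incircle A B C O r D E F ->
  D = B + (ravi B C A / (ravi B C A + ravi C A B)) *: (C - B).
Proof.
move=> tri [_ [[_ pD dD] [t /andP[t0 t1] hD]] [[_ pE dE] [s /andP[s0 s1] hE]]
  [[_ pF dF] [w /andP[w0 w1] hF]]].
have [D1 D2] := tangent_length hD pD dD.
have [E1 E2] := tangent_length hE pE dE.
have [F1 F2] := tangent_length hF pF dF.
have y0 : 0 < ravi B C A by apply: ravi_gt0; rewrite -triangleC.
have z0 : 0 < ravi C A B by apply: ravi_gt0; rewrite triangleC.
have ha := ravi_dist B C A.
have BD : t * dist B C = (1 - w) * dist A B.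
  by apply: sqr_inj D1 F2; rewrite mulr_ge0 ?dist_ge0 // subr_ge0.
have CE : s * dist C A = (1 - t) * dist B C.
  by apply: sqr_inj E1 D2; rewrite mulr_ge0 ?dist_ge0 // subr_ge0.
have AF : w * dist A B = (1 - s) * dist C A.
  by apply: sqr_inj F1 E2; rewrite mulr_ge0 ?dist_ge0 // subr_ge0.
suff -> : ravi B C A / (ravi B C A + ravi C A B) = t by [].
apply: (canLR (mulfK _)); first by apply/lt0r_neq0/addr_gt0.
rewrite ha {1}/ravi -!lock; lra.
Qed.

Lemma incircleC A B C O r D E F :
  incircle A B C O r D E F -> incircle B C A O r E F D.
Proof. by case=> r0 hD hE hF; split. Qed.

Lemma excontact_unique A B C D :
  triangle A B C -> excontact A B C D ->
  D = B + (ravi C A B / (ravi B C A + ravi C A B)) *: (C - B).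
Proof.
move=> tri [O [r [E [F [_ [[_ pD dD] [t /andP[t0 t1] hD]]
  [[_ pE dE] [s /andP[s0 s1] hE]] [[_ pF dF] [w /andP[w0 w1] hF]]]]]]].
have tri' := tri; rewrite triangleC in tri'.
have tri'' := tri'; rewrite triangleC in tri''.
have x0 := ravi_gt0 tri; have y0 := ravi_gt0 tri'; have z0 := ravi_gt0 tri''.
have ha := ravi_dist B C A; have hb := ravi_dist C A B; have hc := ravi_dist A B C.
have sn0 : s != 0.
  apply: contraTneq tri'' => s00; rewrite /triangle /on_line negbK hE s00.
  by rewrite /cross !mxE; apply/eqP; ring.
have wn0 : w != 0.
  apply: contraTneq tri => w00; rewrite /triangle /on_line negbK hF w00.
  by rewrite /cross !mxE; apply/eqP; ring.
(* [C] lies between [A] and [E]; inverting the segment parameter puts [E] on the line [AC] with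
   parameter [s^-1 >= 1], as [tangent_length] expects. *)
have iE : E = A + s^-1 *: (C - A).
  by rewrite hE addrAC subrr add0r scalerA mulVf // scale1r addrC subrK.
have iF : F = A + w^-1 *: (B - A).
  by rewrite hF addrAC subrr add0r scalerA mulVf // scale1r addrC subrK.
have s1' : 1 <= s^-1 by rewrite invf_ge1 // lt0r sn0.
have w1' : 1 <= w^-1 by rewrite invf_ge1 // lt0r wn0.
have pE' : dot (E - O) (C - A) = 0.
  by rewrite -[RHS]oppr0 -pE !dotE !mxE; ring.
have [D1 D2] := tangent_length hD pD dD.
have [E1 E2] := tangent_length iE pE' dE.
have [F1 F2] := tangent_length iF pF dF.
(* Beyond the vertex [1 - s^-1] is at most 0, so its sign is flipped before the squares are
   compared. *)
rewrite -sqrrN -mulNr opprB in E2; rewrite -sqrrN -mulNr opprB in F2.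
have AE : s^-1 * dist A C = w^-1 * dist A B.
  by apply: sqr_inj E1 F1; rewrite mulr_ge0 ?dist_ge0 ?invr_ge0.
have BD : t * dist B C = (w^-1 - 1) * dist A B.
  by apply: sqr_inj D1 F2; rewrite mulr_ge0 ?dist_ge0 // subr_ge0.
have CE : (1 - t) * dist B C = (s^-1 - 1) * dist A C.
  by apply: sqr_inj D2 E2; rewrite mulr_ge0 ?dist_ge0 // subr_ge0.
suff -> : ravi C A B / (ravi B C A + ravi C A B) = t by [].
apply: (canLR (mulfK _)); first by apply/lt0r_neq0/addr_gt0.
rewrite (distC A C) in AE CE.
by rewrite ha {1}/ravi -!lock; lra.
Qed.

End Ravi.

(** * Barycentric coordinates *)

Section Barycentric.
Variable R : rcfType.
Implicit Types (A B C D E F O P T X Y : 'rV[R]_2) (a b c k r x y z : R).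

(** A triple of sum zero yields the origin, since the inverse of 0 is 0; hence the nonzero-sum
    hypotheses below. *)
Definition bary A B C x y z : 'rV[R]_2 :=
  (x + y + z)^-1 *: (x *: A + y *: B + z *: C).

Lemma baryC A B C x y z : bary A B C x y z = bary B C A y z x.
Proof.
rewrite /bary -[x + y + z]addrA -[x *: A + _ + _]addrA.
by rewrite ![_ + (_ + z *: _)]addrC [x + _]addrC.
Qed.

Lemma bary_vertex A B C : A = bary A B C 1 0 0.
Proof. by rewrite /bary !addr0 invr1 !scale1r !scale0r !addr0. Qed.

Lemma barycentric_bary A B C x y z :
  x + y + z != 0 -> barycentric A B C (bary A B C x y z) x y z.
Proof. by move=> s0; split=> //; rewrite /bary scalerA divff // scale1r. Qed.

Lemma bary_scale A B C k x y z :
  k != 0 -> bary A B C (k * x) (k * y) (k * z) = bary A B C x y z.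
Proof.
move=> k0; rewrite /bary -!mulrDr -![(k * _) *: _]scalerA -!scalerDr scalerA.
by rewrite invfM mulrAC mulVf // mul1r.
Qed.

Lemma bary_split A B C x y z : x + y + z != 0 ->
  bary A B C x y z
  = A + (y / (x + y + z)) *: (B - A) + (z / (x + y + z)) *: (C - A).
Proof. by move=> s0; apply: rV2P; rewrite !mxE; field. Qed.

(** Differences are expanded in the basis [B - A], [C - A], where [dot_comb] and [cross_comb]
    apply. *)
Lemma baryB A B C x y z x' y' z' : x + y + z != 0 -> x' + y' + z' != 0 ->
  bary A B C x y z - bary A B C x' y' z'
  = (y / (x + y + z) - y' / (x' + y' + z')) *: (B - A)
    + (z / (x + y + z) - z' / (x' + y' + z')) *: (C - A).
Proof. by move=> s0 s0'; apply: rV2P; rewrite !mxE; field; apply/andP. Qed.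

Lemma baryP A B C X : triangle A B C ->
  exists x y z, x + y + z = 1 /\ X = bary A B C x y z.
Proof.
rewrite /triangle /on_line => d0.
(* Barycentric coordinates are ratios of signed areas. *)
pose y := cross (X - A) (C - A) / cross (B - A) (C - A).
pose z := cross (B - A) (X - A) / cross (B - A) (C - A).
exists (1 - y - z), y, z; have s1 : 1 - y - z + y + z = 1 by ring.
split=> //; rewrite bary_split s1 ?oner_eq0 // !divr1 /y /z.
by apply: rV2P; move: d0; rewrite /cross !mxE => d0; field.
Qed.

(** Equal points have proportional triples; the factor is the ratio of the sums, cleared here by
    cross multiplication. *)
Lemma bary_inj A B C x y z x' y' z' : triangle A B C ->
  x + y + z != 0 -> x' + y' + z' != 0 ->
  bary A B C x y z = bary A B C x' y' z' ->
  x * (x' + y' + z') = x' * (x + y + z)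
  /\ y * (x' + y' + z') = y' * (x + y + z)
  /\ z * (x' + y' + z') = z' * (x + y + z).
Proof.
rewrite /triangle /on_line => d0 s0 s0' /eqP; rewrite -subr_eq0 baryB // => /eqP e.
have hy : y / (x + y + z) - y' / (x' + y' + z') = 0.
  apply: (mulIf d0); rewrite mul0r.
  have := cross_comb (B - A) (C - A)
    (y / (x + y + z) - y' / (x' + y' + z')) (z / (x + y + z) - z' / (x' + y' + z')) 0 1.
  by rewrite e mulr1 mulr0 subr0 => <-; rewrite /cross !mxE; ring.
have hz : z / (x + y + z) - z' / (x' + y' + z') = 0.
  apply: (mulIf d0); rewrite mul0r.
  have := cross_comb (B - A) (C - A) 1 0
    (y / (x + y + z) - y' / (x' + y' + z')) (z / (x + y + z) - z' / (x' + y' + z')).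
  by rewrite e mul0r mul1r subr0 => <-; rewrite /cross !mxE; ring.
move/eqP: hy; rewrite subr_eq0 eqr_div // => /eqP hy.
move/eqP: hz; rewrite subr_eq0 eqr_div // => /eqP hz.
by split=> //; lra.
Qed.

(** Up to the three sums, the cross product is the determinant of the coordinates times that of the
    reference triangle. *)
Lemma on_line_bary A B C x y z x' y' z' x'' y'' z'' : triangle A B C ->
  x + y + z != 0 -> x' + y' + z' != 0 -> x'' + y'' + z'' != 0 ->
  on_line (bary A B C x y z) (bary A B C x' y' z') (bary A B C x'' y'' z'')
  = (x * (y' * z'' - z' * y'') - y * (x' * z'' - z' * x'')
     + z * (x' * y'' - y' * x'') == 0).
Proof.
rewrite /triangle {1}/on_line => d0 s0 s0' s0''.
rewrite /on_line !baryB // cross_comb mulf_eq0 (negPf d0) orbF.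
rewrite -(mulrI_eq0 _ (mulfI s0)) -(mulrI_eq0 _ (mulfI s0')).
by rewrite -(mulrI_eq0 _ (mulfI s0'')); congr (_ == 0); field; do ?[apply/andP; split].
Qed.

Lemma parallel_bary A B C x y z x' y' z' u v w : triangle A B C ->
  x + y + z != 0 -> x' + y' + z' != 0 -> u + v + w != 0 ->
  (cross (bary A B C x y z - bary A B C x' y' z') (bary A B C u v w - A) == 0)
  = ((y * (x' + y' + z') - y' * (x + y + z)) * w
     == (z * (x' + y' + z') - z' * (x + y + z)) * v).
Proof.
rewrite /triangle /on_line => d0 s0 s0' s1.
rewrite {4}(bary_vertex A B C) !baryB // ?addr0 ?oner_eq0 //.
rewrite cross_comb mulf_eq0 (negPf d0) orbF -[in RHS]subr_eq0.
rewrite -(mulrI_eq0 _ (mulfI s0)) -(mulrI_eq0 _ (mulfI s0')).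
by rewrite -(mulrI_eq0 _ (mulfI s1)); congr (_ == 0); field; do ?[apply/andP; split].
Qed.

(** The complement of [X] is half of [A + B + C - X], which replaces each coordinate by the sum of
    the other two. *)
Lemma complement_bary A B C x y z : x + y + z != 0 ->
  complement A B C (bary A B C x y z) = bary A B C (y + z) (z + x) (x + y).
Proof.
move=> s0; have s0' : y + z + (z + x) + (x + y) != 0.
  have -> : y + z + (z + x) + (x + y) = 2 * (x + y + z) by ring.
  by rewrite mulf_neq0 ?pnatr_eq0.
apply: rV2P; rewrite !mxE; field.
all: by do ?[apply/andP; split].
Qed.

End Barycentric.

(** * Contact points and triangle centers in barycentric coordinates *)

Section Contact.
Variable R : rcfType.
Implicit Types (A B C D E F O P T X Y : 'rV[R]_2) (a b c k r x y z : R).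

Lemma dot_baryB A B C y z y' z' :
  dot (y *: (B - A) + z *: (C - A)) (y' *: (B - A) + z' *: (C - A))
  = y * y' * (ravi A B C + ravi B C A) ^+ 2
    + (y * z' + z * y') * (ravi A B C ^+ 2 + ravi A B C * ravi B C A
        + ravi A B C * ravi C A B - ravi B C A * ravi C A B)
    + z * z' * (ravi C A B + ravi A B C) ^+ 2.
Proof. by rewrite dot_comb (dot_ravi A B C) -!sqr_dist !ravi_dist (distC A C). Qed.

Lemma ravi_pos A B C : triangle A B C ->
  [/\ 0 < ravi A B C, 0 < ravi B C A & 0 < ravi C A B].
Proof.
move=> tri; split; first exact: ravi_gt0.
  by apply: ravi_gt0; rewrite -triangleC.
by apply: ravi_gt0; rewrite triangleC.
Qed.

Lemma edge_bary A B C y z : y + z != 0 ->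
  B + (z / (y + z)) *: (C - B) = bary A B C 0 y z.
Proof. by move=> s0; rewrite /bary add0r; apply: rV2P; rewrite !mxE; field. Qed.

(** Tangent lengths give uniqueness; the converse constructs the excircle, which the existence of
    the Nagel point requires. *)
Lemma excontactP A B C D : triangle A B C ->
  excontact A B C D <-> D = bary A B C 0 (ravi B C A) (ravi C A B).
Proof.
move=> tri; have [x0 y0 z0] := ravi_pos tri.
set x := ravi A B C in x0 *; set y := ravi B C A in y0 *.
set z := ravi C A B in z0 *.
have dotB : forall u v u' v',
    dot (u *: (B - A) + v *: (C - A)) (u' *: (B - A) + v' *: (C - A))
  = u * u' * (x + y) ^+ 2 + (u * v' + v * u') * (x ^+ 2 + x * y + x * z - y * z)
    + v * v' * (z + x) ^+ 2 by exact: dot_baryB.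
split=> [/(excontact_unique tri) ->|->].
  by rewrite (edge_bary A) // lt0r_neq0 // addr_gt0.
have [xn0 yzn0] : x != 0 /\ y + z != 0 by split; apply: lt0r_neq0; rewrite ?addr_gt0.
have xyn0 : x + y != 0 by rewrite lt0r_neq0 ?addr_gt0.
have zxn0 : z + x != 0 by rewrite lt0r_neq0 ?addr_gt0.
have xyz0 : x + y + z != 0 by rewrite lt0r_neq0 ?addr_gt0.
have dBC : 0 + y + z != 0 by rewrite add0r.
have dCA' : - y + (x + y + z) != 0 by have -> : - y + (x + y + z) = z + x by ring.
have dAB' : - z + (x + y + z) != 0 by have -> : - z + (x + y + z) = x + y by ring.
have dCA : - y + 0 + (x + y + z) != 0 by rewrite addr0.
have dAB : - z + (x + y + z) + 0 != 0 by rewrite addr0.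
have dO : - (y + z) + (z + x) + (x + y) != 0.
  have -> : - (y + z) + (z + x) + (x + y) = 2 * x by ring.
  by rewrite mulf_neq0 // pnatr_eq0.
have CB : C - B = (-1) *: (B - A) + 1 *: (C - A).
  by apply: rV2P; rewrite !mxE; ring.
have AC : A - C = 0 *: (B - A) + (-1) *: (C - A).
  by apply: rV2P; rewrite !mxE; ring.
have BA : B - A = 1 *: (B - A) + 0 *: (C - A).
  by apply: rV2P; rewrite !mxE; ring.
have frac01 (u v : R) : 0 < u -> 0 < v -> 0 <= u / (u + v) <= 1.
  move=> u0 v0; have uv0 := addr_gt0 u0 v0.
  rewrite ler_pdivrMr // mul1r lerDl (ltW v0) andbT.
  by rewrite divr_ge0 // ltW.
(* The excenter is [(-a : b : c)]. The radius is the area over [x], rewritten by Heron; the other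
   two contact points are at distance [x + y + z] from [A]. *)
exists (bary A B C (- (y + z)) (z + x) (x + y)), (Num.sqrt ((x + y + z) * y * z / x)).
exists (bary A B C (- y) 0 (x + y + z)), (bary A B C (- z) (x + y + z) 0).
split; first by rewrite sqrtr_gt0 divr_gt0 ?mulr_gt0 ?addr_gt0.
- split; last first.
    exists (z / (y + z)); first by rewrite [y + z]addrC frac01.
    by rewrite (edge_bary A).
  split; first by rewrite /on_line -(edge_bary A) // /cross !mxE; apply/eqP; ring.
    by rewrite baryB // CB dotB; field; do ?[apply/andP; split].
  congr Num.sqrt; rewrite baryB // dotB; field.
  by do ?[apply/andP; split].
- split; last first.
    exists ((z + x) / (x + y + z)).
      have -> : x + y + z = z + x + y by ring.
      by rewrite frac01 ?addr_gt0.
    by rewrite bary_split //; apply: rV2P; rewrite !mxE; field; do ?[apply/andP; split].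
  split; first by rewrite /on_line bary_split // /cross !mxE; apply/eqP; field.
    by rewrite baryB // AC dotB; field; do ?[apply/andP; split].
  congr Num.sqrt; rewrite baryB // dotB; field.
  by do ?[apply/andP; split].
split; last first.
  exists ((x + y) / (x + y + z)); first by rewrite frac01 ?addr_gt0.
  by rewrite bary_split //; apply: rV2P; rewrite !mxE; field; do ?[apply/andP; split].
split; first by rewrite /on_line bary_split // /cross !mxE; apply/eqP; field.
  by rewrite baryB // {2}BA dotB; field; do ?[apply/andP; split].
congr Num.sqrt; rewrite baryB // dotB; field.
by do ?[apply/andP; split].
Qed.

(** Both the center and the candidate lie on the perpendiculars to [BC] at [D] and to [CA] at [E],
    and these meet only once. *)
Lemma incircle_center A B C O r D E F : triangle A B C ->
  incircle A B C O r D E F ->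
  O = bary A B C (ravi B C A + ravi C A B) (ravi C A B + ravi A B C)
        (ravi A B C + ravi B C A).
Proof.
move=> tri inc; have [x0 y0 z0] := ravi_pos tri.
have tri' := tri; rewrite triangleC in tri'.
have := incircle_contact tri inc; have := incircle_contact tri' (incircleC inc).
move: inc => [_ [[_ pD _] _] [[_ pE _] _] _].
set x := ravi A B C in x0 *; set y := ravi B C A in y0 *.
set z := ravi C A B in z0 *.
have dotB : forall u v u' v',
    dot (u *: (B - A) + v *: (C - A)) (u' *: (B - A) + v' *: (C - A))
  = u * u' * (x + y) ^+ 2 + (u * v' + v * u') * (x ^+ 2 + x * y + x * z - y * z)
    + v * v' * (z + x) ^+ 2 by exact: dot_baryB.
have yz0 : y + z != 0 by rewrite lt0r_neq0 ?addr_gt0.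
have zy0 : z + y != 0 by rewrite lt0r_neq0 ?addr_gt0.
have zx0 : z + x != 0 by rewrite lt0r_neq0 ?addr_gt0.
have xz0 : x + z != 0 by rewrite lt0r_neq0 ?addr_gt0.
have s0 : y + z + (z + x) + (x + y) != 0 by rewrite lt0r_neq0 ?addr_gt0.
rewrite [y + z]addrC [z + x]addrC => hE hD.
rewrite (edge_bary A) // in hD; rewrite (edge_bary B) // -baryC in hE.
rewrite [z + y]addrC [x + z]addrC.
apply/eqP; rewrite eq_sym -subr_eq0; apply/eqP.
have d0 : cross (C - B) (A - C) != 0.
  by move: tri; rewrite /triangle /on_line; congr (_ != 0); rewrite /cross !mxE; ring.
have dE : z + 0 + x != 0 by rewrite addr0.
have dD : 0 + z + y != 0 by rewrite add0r.
have CB : C - B = (-1) *: (B - A) + 1 *: (C - A).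
  by apply: rV2P; rewrite !mxE; ring.
have AC : A - C = 0 *: (B - A) + (-1) *: (C - A).
  by apply: rV2P; rewrite !mxE; ring.
set Q := bary _ _ _ _ _ _.
have perp T v : dot (T - O) v = 0 -> dot (T - Q) v = 0 -> dot (Q - O) v = 0.
  by rewrite !dotE !mxE; lra.
apply: (perp_basis_eq0 d0); [apply: (perp D) => //|apply: (perp E) => //].
  by rewrite hD /Q baryB // CB dotB; field; do ?[apply/andP; split].
by rewrite hE /Q baryB // AC dotB; field; do ?[apply/andP; split].
Qed.

(** The cevians from [A] and [B] already give [x * p = y * q = z * s], that is, coordinates
    proportional to the reciprocals of [x], [y], [z]. *)
Lemma gergonne_bary A B C P : triangle A B C -> gergonne A B C P ->
  P = bary A B C (ravi B C A * ravi C A B) (ravi C A B * ravi A B C)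
        (ravi A B C * ravi B C A).
Proof.
move=> tri [O [r [D [E [F [inc [hD hE _]]]]]]]; have [x0 y0 z0] := ravi_pos tri.
have tri' := tri; rewrite triangleC in tri'.
move: hD hE.
rewrite (incircle_contact tri' (incircleC inc)) (incircle_contact tri inc).
have [p [q [s [s1 ->]]]] := baryP P tri.
set x := ravi A B C in x0 *; set y := ravi B C A in y0 *.
set z := ravi C A B in z0 *.
have zy0 : z + y != 0 by rewrite lt0r_neq0 ?addr_gt0.
have xz0 : x + z != 0 by rewrite lt0r_neq0 ?addr_gt0.
have d100 : 1 + 0 + 0 != 0 :> R by rewrite !addr0 oner_eq0.
have d010 : 0 + 1 + 0 != 0 :> R by rewrite add0r addr0 oner_eq0.
have dE : z + 0 + x != 0 by rewrite addr0 addrC.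
have dD : 0 + z + y != 0 by rewrite add0r.
have n1 : p + q + s != 0 by rewrite s1 oner_eq0.
rewrite [y + z]addrC [z + x]addrC (edge_bary A) // (edge_bary B) // -(baryC A B C).
rewrite {1}(bary_vertex A B C) on_line_bary // => /eqP e1.
have vB : B = bary A B C 0 1 0 by rewrite baryC -bary_vertex.
rewrite {1}vB on_line_bary // => /eqP e2.
have k0 : y * z + z * x + x * y != 0 by rewrite lt0r_neq0 // !addr_gt0 ?mulr_gt0.
have kE : x * p = z * s by lra.
have kE' : y * q = z * s by lra.
(* Scaling each triple by the sum of the other makes the triples equal entrywise. *)
rewrite -(bary_scale A B C p q s (k := y * z + z * x + x * y)) //.
rewrite -(bary_scale A B C (y * z) (z * x) (x * y) (k := p + q + s)) //.
by congr bary; nra.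
Qed.

(** Products instead of the reciprocals of [Sa], [Sb], [Sc] keep right triangles included; their sum
    is the square of twice the area. *)
Lemma orthocenter_bary A B C H : triangle A B C -> orthocenter A B C H ->
  let Sa := dot (B - A) (C - A) in
  let Sb := dot (C - B) (A - B) in
  let Sc := dot (A - C) (B - C) in
  Sb * Sc + Sc * Sa + Sa * Sb != 0 /\ H = bary A B C (Sb * Sc) (Sc * Sa) (Sa * Sb).
Proof.
move=> tri [hA hB _] Sa Sb Sc.
have d0 : cross (C - B) (A - C) != 0.
  by move: tri; rewrite /triangle /on_line; congr (_ != 0); rewrite /cross !mxE; ring.
have eS : Sb * Sc + Sc * Sa + Sa * Sb = cross (C - B) (A - C) ^+ 2.
  by rewrite /Sa /Sb /Sc !dotE /cross !mxE; ring.
have s0 : Sb * Sc + Sc * Sa + Sa * Sb != 0 by rewrite eS sqrf_eq0.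
split=> //; apply/eqP; rewrite -subr_eq0; apply/eqP.
have scaled v w : (Sb * Sc + Sc * Sa + Sa * Sb)
    * dot (bary A B C (Sb * Sc) (Sc * Sa) (Sa * Sb) - v) w
  = dot (Sb * Sc *: (A - v) + Sc * Sa *: (B - v) + Sa * Sb *: (C - v)) w.
  by rewrite !dotE !mxE; field.
have perp T v w : dot (H - T) w = 0 ->
    dot (Sb * Sc *: (A - T) + Sc * Sa *: (B - T) + Sa * Sb *: (C - T)) w = 0 ->
    dot (H - bary A B C (Sb * Sc) (Sc * Sa) (Sa * Sb)) w = v -> v = 0.
  rewrite -scaled => h1 /eqP; rewrite mulf_eq0 (negPf s0) => /eqP h2 <-.
  by move: h1 h2; rewrite !dotE !mxE; lra.
apply: (perp_basis_eq0 d0).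
  by apply: (perp A _ _ hA) => //; rewrite /Sa /Sb /Sc !dotE !mxE; ring.
by apply: (perp B _ _ hB) => //; rewrite /Sa /Sb /Sc !dotE !mxE; ring.
Qed.

Lemma on_side_bary A B C x y z : triangle A B C -> x + y + z != 0 ->
  on_line B C (bary A B C x y z) = (x == 0).
Proof.
move=> tri s0; have h0 : 0 + 1 + 0 != 0 :> R by rewrite add0r addr0 oner_eq0.
have h1 : 0 + 0 + 1 != 0 :> R by rewrite !add0r oner_eq0.
rewrite [X in on_line X _ _](bary_vertex B C A) -(baryC A).
rewrite [X in on_line _ X _](bary_vertex C A B) -(baryC B) -(baryC A).
by rewrite on_line_bary //; congr (_ == 0); ring.
Qed.

Lemma on_cevian_bary A B C x y z x' y' z' : triangle A B C ->
  x + y + z != 0 -> x' + y' + z' != 0 ->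
  on_line A (bary A B C x y z) (bary A B C x' y' z') = (y * z' == z * y').
Proof.
move=> tri s0 s0'; have h0 : 1 + 0 + 0 != 0 :> R by rewrite !addr0 oner_eq0.
rewrite [X in on_line X _ _](bary_vertex A B C) on_line_bary //.
by rewrite -[in RHS]subr_eq0; congr (_ == 0); ring.
Qed.

End Contact.

(** * Circumconics *)

Section Conic.
Variable R : rcfType.
Implicit Types (A B C X : 'rV[R]_2) (M N : 'M[R]_(2 + 1)) (k l m n w x y z : R).

Let i0 : 'I_(2 + 1) := @Ordinal 3 0 isT.
Let i1 : 'I_(2 + 1) := @Ordinal 3 1 isT.
Let i2 : 'I_(2 + 1) := @Ordinal 3 2 isT.

Lemma big_ord3 (f : 'I_(2 + 1) -> R) : \sum_i f i = f i0 + f i1 + f i2.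
Proof.
rewrite !big_ord_recl big_ord0 addr0 addrA.
by congr (f _ + f _ + f _); apply: val_inj.
Qed.

Lemma ord3P (i : 'I_(2 + 1)) : [\/ i = i0, i = i1 | i = i2].
Proof.
by case: i => [[|[|[|//]]] ?]; [constructor 1|constructor 2|constructor 3];
  apply: val_inj.
Qed.

(** Reading entries through a function on [nat] lets the lifted ordinals of the cofactor expansion
    reduce to numerals. *)
Lemma det3 M (f : nat -> nat -> R) : (forall i j, M i j = f i j) ->
  \det M = f 0 0 * (f 1 1 * f 2 2 - f 1 2 * f 2 1)
    - f 0 1 * (f 1 0 * f 2 2 - f 1 2 * f 2 0)
    + f 0 2 * (f 1 0 * f 2 1 - f 1 1 * f 2 0).
Proof.
move=> h; rewrite (expand_det_row _ ord0) !big_ord_recl big_ord0 /cofactor.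
rewrite !(expand_det_row _ (0 : 'I_2)) !big_ord_recl !big_ord0 /cofactor.
by rewrite !det_mx11 !mxE !h /= /bump /=; ring.
Qed.

Definition row3 x y z : 'rV[R]_(2 + 1) := \row_j [:: x; y; z]`_j.

(** The change of basis from barycentric to homogeneous Cartesian coordinates. *)
Definition frame A B C : 'M[R]_(2 + 1) :=
  \matrix_(i, j) let X := [:: A; B; C]`_i in [:: X 0 0; X 0 1; 1]`_j.

Lemma row_mx_coords X w :
  row_mx X (w%:M : 'M_1) = row3 (X 0 0) (X 0 1) w.
Proof.
apply/rowP=> j; rewrite !mxE; case: splitP => k e.
  rewrite e; case: k {e} => [[|[|//]] ?] /=; congr (X _ _); exact: val_inj.
by rewrite e (ord1 k) /= mxE eqxx.
Qed.

Lemma row3_frame A B C x y z :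
  row3 x y z *m frame A B C
  = row_mx (x *: A + y *: B + z *: C) ((x + y + z)%:M : 'M_1).
Proof.
rewrite row_mx_coords; apply/rowP=> j; rewrite mxE big_ord3 !mxE.
by have [->|->|->] := ord3P j; rewrite /= ?mulr1.
Qed.

Lemma quad3 M x y z : (row3 x y z *m M *m (row3 x y z)^T) 0 0
  = M i0 i0 * x ^+ 2 + M i1 i1 * y ^+ 2 + M i2 i2 * z ^+ 2
    + (M i0 i1 + M i1 i0) * (x * y) + (M i0 i2 + M i2 i0) * (z * x)
    + (M i1 i2 + M i2 i1) * (y * z).
Proof. by rewrite mxE big_ord3 !mxE !big_ord3 !mxE /=; ring. Qed.

(** Off the diagonal [i + j] is 1, 2 or 3 and determines the unordered pair, so the lookup is
    symmetric; entry 0 of the list is a filler. *)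
Definition circ l m n : 'M[R]_(2 + 1) :=
  \matrix_(i, j) (if i == j then 0 else [:: 0; n; m; l]`_(i + j)).

(* [M] is the conic [l YZ + m ZX + n XY = 0] in barycentric coordinates. *)
Definition circumconic A B C l m n M :=
  frame A B C *m M *m (frame A B C)^T = circ l m n.

Lemma det_circ l m n : \det (circ l m n) = 2 * l * m * n.
Proof.
pose f (i j : nat) := if i == j then 0 else [:: 0; n; m; l]`_(i + j).
by rewrite (det3 (f := f)) => [|i j]; rewrite ?mxE // /f /=; ring.
Qed.

Lemma det_frame A B C : \det (frame A B C) = cross (B - A) (C - A).
Proof.
pose f (i j : nat) := let X := [:: A; B; C]`_i in [:: X 0 0; X 0 1; 1]`_j.
rewrite (det3 (f := f)) => [|i j]; first by rewrite /f /cross !mxE /=; ring.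
by rewrite mxE.
Qed.

Lemma unit_frame A B C : triangle A B C -> frame A B C \in unitmx.
Proof. by rewrite unitmxE det_frame unitfE. Qed.

Lemma conic_form_cart M X w : M^T = M -> conic_form M X w
  = M i0 i0 * X 0 0 ^+ 2 + M i1 i1 * X 0 1 ^+ 2 + M i2 i2 * w ^+ 2
    + 2 * M i0 i1 * (X 0 0 * X 0 1) + 2 * M i0 i2 * (w * X 0 0)
    + 2 * M i1 i2 * (X 0 1 * w).
Proof.
move=> sM; rewrite /conic_form row_mx_coords quad3.
have e i j : M j i = M i j by rewrite -{1}sM mxE.
by rewrite (e i0 i1) (e i0 i2) (e i1 i2); ring.
Qed.

Lemma conic_formZ M k X w : conic_form M (k *: X) (k * w) = k ^+ 2 * conic_form M X w.
Proof. by rewrite /conic_form !row_mx_coords !quad3 !mxE; ring. Qed.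

Lemma conic_form_frame A B C M x y z :
  conic_form M (x *: A + y *: B + z *: C) (x + y + z)
  = (row3 x y z *m (frame A B C *m M *m (frame A B C)^T) *m (row3 x y z)^T) 0 0.
Proof. by rewrite /conic_form /= -row3_frame trmx_mul !mulmxA. Qed.

(** The sum [x + y + z] may vanish, so directions are covered as well; the rectangularity criterion
    uses this. *)
Lemma conic_form_circum A B C l m n M x y z : circumconic A B C l m n M ->
  conic_form M (x *: A + y *: B + z *: C) (x + y + z)
  = 2 * (l * (y * z) + m * (z * x) + n * (x * y)).
Proof. by rewrite conic_form_frame => ->; rewrite quad3 !mxE /=; ring. Qed.

Lemma on_circumconic A B C l m n M x y z :
  circumconic A B C l m n M -> x + y + z != 0 ->
  on_conic M (bary A B C x y z)
  = (l * (y * z) + m * (z * x) + n * (x * y) == 0).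
Proof.
move=> cM s0; rewrite /on_conic /bary -(mulVf s0) conic_formZ.
rewrite (conic_form_circum _ _ _ cM) mulf_eq0 sqrf_eq0 invr_eq0 (negPf s0) /=.
by rewrite mulf_eq0 pnatr_eq0.
Qed.

(** In the barycentric frame, the values at the three vertices are the diagonal entries. *)
Lemma circumconicP A B C N : conic N -> all (on_conic N) [:: A; B; C] ->
  exists l m n, circumconic A B C l m n N.
Proof.
move=> [sN _] /and4P[/eqP hA /eqP hB /eqP hC _].
have := conic_form_frame A B C N 1 0 0; have := conic_form_frame A B C N 0 1 0.
have := conic_form_frame A B C N 0 0 1.
rewrite !scale1r !scale0r ?addr0 ?add0r hA hB hC !quad3 /circumconic.
set S := frame A B C *m N *m _ => eC eB eA.
have sS : S^T = S by rewrite /S !trmx_mul trmxK sN mulmxA.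
have sym i j : S j i = S i j by rewrite -{1}sS mxE.
exists (S i1 i2), (S i0 i2), (S i0 i1); apply/matrixP=> i j; rewrite [RHS]mxE.
move: eA eB eC.
rewrite !expr1n !expr0n /= !(mulr0, mul0r, mulr1, mul1r, addr0, add0r) => eA eB eC.
case: (ord3P i) => ->; case: (ord3P j) => -> //=;
  by rewrite ?(sym i0 i1, sym i0 i2, sym i1 i2) -?eA -?eB -?eC.
Qed.

Lemma circumconic_scale A B C k l m n M N : triangle A B C ->
  circumconic A B C l m n M -> circumconic A B C (k * l) (k * m) (k * n) N ->
  N = k *: M.
Proof.
move=> /unit_frame U cM cN.
have U' : (frame A B C)^T \in unitmx by rewrite unitmx_tr.
have e : frame A B C *m N *m (frame A B C)^T
  = frame A B C *m (k *: M) *m (frame A B C)^T.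
  rewrite cN -scalemxAr -scalemxAl cM; apply/matrixP=> i j; rewrite !mxE.
  by case: (ord3P i) => ->; case: (ord3P j) => -> /=; rewrite ?mulr0.
by rewrite -[LHS](mulKmx U) -[in LHS](mulmxK U' (_ *m N)) e mulmxK // mulKmx.
Qed.

Lemma circumconic_ex A B C l m n : triangle A B C -> l != 0 -> m != 0 -> n != 0 ->
  exists M, [/\ conic M, circumconic A B C l m n M & \det M != 0].
Proof.
move=> tri l0 m0 n0; have U := unit_frame tri.
have U' : (frame A B C)^T \in unitmx by rewrite unitmx_tr.
exists (invmx (frame A B C) *m circ l m n *m invmx (frame A B C)^T).
set M := _ *m _.
have cM : circumconic A B C l m n M.
  by rewrite /circumconic /M !mulmxA mulmxV // mul1mx mulmxKV.
have dM : \det M != 0.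
  have : \det (circ l m n) != 0.
    by rewrite det_circ !mulf_neq0 // pnatr_eq0.
  by rewrite -cM !det_mulmx !mulf_eq0 !negb_or => /andP[/andP[]].
split=> //; split; last by apply: contraNneq dM => ->; rewrite det0.
rewrite /M !trmx_mul !trmx_inv trmxK mulmxA; congr (_ *m _ *m _).
apply/matrixP=> i j; rewrite !mxE.
by case: (ord3P i) => ->; case: (ord3P j) => ->.
Qed.

(** Both coefficient triples are orthogonal to [u] and [v], hence multiples of their cross product,
    whose first entry is nonzero. The ratio [l' / l] is nonzero because [N] is. *)
Lemma circumconic_unique A B C l m n M N (u v : R * R * R) : triangle A B C ->
  circumconic A B C l m n M -> l != 0 ->
  l * u.1.1 + m * u.1.2 + n * u.2 = 0 -> l * v.1.1 + m * v.1.2 + n * v.2 = 0 ->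
  u.1.2 * v.2 - u.2 * v.1.2 != 0 ->
  conic N -> all (on_conic N) [:: A; B; C] ->
  (forall l' m' n', circumconic A B C l' m' n' N ->
     l' * u.1.1 + m' * u.1.2 + n' * u.2 = 0
     /\ l' * v.1.1 + m' * v.1.2 + n' * v.2 = 0) ->
  same_conic M N.
Proof.
case: u v => [[u0 u1] u2] [[v0 v1] v2] /= tri cM l0 e1 e2 w0 cN thru uv.
have [l' [m' [n' cN']]] := circumconicP cN thru.
have [e1' e2'] := uv _ _ _ cN'.
have hm a b c : a * u0 + b * u1 + c * u2 = 0 -> a * v0 + b * v1 + c * v2 = 0 ->
    b * (u1 * v2 - u2 * v1) = a * (u2 * v0 - u0 * v2)
    /\ c * (u1 * v2 - u2 * v1) = a * (u0 * v1 - u1 * v0).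
  move=> h1 h2; split; apply/eqP; rewrite -subr_eq0; apply/eqP.
    transitivity ((a * u0 + b * u1 + c * u2) * v2 - (a * v0 + b * v1 + c * v2) * u2).
      by ring.
    by rewrite h1 h2; ring.
  transitivity ((a * v0 + b * v1 + c * v2) * u1 - (a * u0 + b * u1 + c * u2) * v1).
    by ring.
  by rewrite h1 h2; ring.
have [em en] := hm _ _ _ e1 e2; have [em' en'] := hm _ _ _ e1' e2'.
have cN'' : circumconic A B C (l' / l * l) (l' / l * m) (l' / l * n) N.
  rewrite divfK //.
  have -> : l' / l * m = m'.
    by apply: (mulIf w0); rewrite em' -[LHS]mulrA em; field.
  have -> // : l' / l * n = n'.
  by apply: (mulIf w0); rewrite en' -[LHS]mulrA en; field.
have NM := circumconic_scale tri cM cN''.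
exists (l' / l) => //; have [_ N0] := cN.
by apply: contraNneq N0 => z0; rewrite NM z0 scale0r.
Qed.

(** The trace of a quadratic form is the sum of its values on any orthonormal pair, so perpendicular
    null directions exist exactly when it vanishes. *)
Lemma rectangularP M : M^T = M ->
  (exists u v, [/\ at_infinity M u, at_infinity M v & dot u v = 0])
  <-> M i0 i0 + M i1 i1 = 0.
Proof.
move=> sM; rewrite /at_infinity; split.
  move=> [u [v [/andP[u0 /eqP eu] /andP[v0 /eqP ev] uv]]].
  move: eu ev uv; rewrite !conic_form_cart // dotE.
  have : u 0 0 ^+ 2 + u 0 1 ^+ 2 != 0.
    apply: contraNneq u0 => /eqP; rewrite paddr_eq0 ?sqr_ge0 // !sqrf_eq0.
    by move=> /andP[/eqP h0 /eqP h1]; apply/eqP/rV2P; rewrite mxE.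
  have : v 0 0 ^+ 2 + v 0 1 ^+ 2 != 0.
    apply: contraNneq v0 => /eqP; rewrite paddr_eq0 ?sqr_ge0 // !sqrf_eq0.
    by move=> /andP[/eqP h0 /eqP h1]; apply/eqP/rV2P; rewrite mxE.
  move: (u 0 0) (u 0 1) (v 0 0) (v 0 1) => a b c d {u0 v0}.
  move: (M i0 i0) (M i0 i1) (M i1 i1) (M i0 i2) (M i1 i2) (M i2 i2) => p q r f g h.
  move=> cd ab eu ev uv; apply: (mulIf cd); apply: (mulIf ab); rewrite !mul0r.
  transitivity ((p * a ^+ 2 + r * b ^+ 2 + h * 0 ^+ 2 + 2 * q * (a * b)
      + 2 * f * (0 * a) + 2 * g * (b * 0)) * (c ^+ 2 + d ^+ 2)
    + (p * c ^+ 2 + r * d ^+ 2 + h * 0 ^+ 2 + 2 * q * (c * d)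
      + 2 * f * (0 * c) + 2 * g * (d * 0)) * (a ^+ 2 + b ^+ 2)
    - (a * c + b * d) * ((p - r) * (a * c - b * d) + 2 * q * (a * d + b * c))).
    by ring.
  by rewrite eu ev uv; ring.
move=> t0.
have [u [u0 eu]] : exists u, u != 0 /\ conic_form M u 0 = 0.
  pose vec a b : 'rV[R]_2 := \row_j [:: a; b]`_j.
  have vec_neq0 a b : b != 0 -> vec a b != 0.
    by apply: contraNneq => /rowP/(_ 1); rewrite !mxE /= => ->.
  have r11 : M i1 i1 = - M i0 i0 by apply/eqP; rewrite -addr_eq0 addrC t0.
  have [p0|p0] := eqVneq (M i0 i0) 0.
    exists (vec 0 1); rewrite vec_neq0 ?oner_eq0 //; split=> //.
    by rewrite conic_form_cart // r11 p0 !mxE /=; ring.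
  (* With zero trace the discriminant is a sum of squares, so a real null direction exists. *)
  pose s := Num.sqrt (M i0 i0 ^+ 2 + M i0 i1 ^+ 2).
  exists (vec (s - M i0 i1) (M i0 i0)); rewrite vec_neq0 //; split=> //.
  have s2 : s ^+ 2 = M i0 i0 ^+ 2 + M i0 i1 ^+ 2.
    by rewrite sqr_sqrtr // addr_ge0 ?sqr_ge0.
  rewrite conic_form_cart // r11 !mxE /=.
  transitivity (M i0 i0 * (s ^+ 2 - (M i0 i0 ^+ 2 + M i0 i1 ^+ 2))); first by ring.
  by rewrite s2 subrr mulr0.
(* A quarter turn of [u]; with zero trace it negates the value of the form. *)
pose v : 'rV[R]_2 := \row_j [:: - u 0 1; u 0 0]`_j.
exists u, v; rewrite u0 eu eqxx; split=> //; last first.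
  by rewrite dotE !mxE /=; ring.
apply/andP; split.
  apply: contraNneq u0 => /rowP e; apply/eqP/rV2P; rewrite mxE.
    by have := e 1; rewrite !mxE.
  by have := e 0; rewrite !mxE /= => /eqP; rewrite oppr_eq0 => /eqP.
apply/eqP; rewrite conic_form_cart // !mxE /=.
move: eu; rewrite conic_form_cart // => eu.
transitivity ((M i0 i0 + M i1 i1) * (u 0 0 ^+ 2 + u 0 1 ^+ 2)
  - (M i0 i0 * u 0 0 ^+ 2 + M i1 i1 * u 0 1 ^+ 2 + M i2 i2 * 0 ^+ 2
    + 2 * M i0 i1 * (u 0 0 * u 0 1) + 2 * M i0 i2 * (0 * u 0 0)
    + 2 * M i1 i2 * (u 0 1 * 0))); first by ring.
by rewrite eu t0; ring.
Qed.

(* The trace of the quadratic part is the sum of its values at the two unit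
   vectors of the axes, whose barycentric coordinates are those below. *)
Lemma circumconic_rectangular A B C l m n M : triangle A B C -> M^T = M ->
  circumconic A B C l m n M ->
  (exists u v, [/\ at_infinity M u, at_infinity M v & dot u v = 0])
  <-> l * dot (B - A) (C - A) + m * dot (C - B) (A - B) + n * dot (A - C) (B - C) = 0.
Proof.
rewrite /triangle /on_line => d0 sM cM.
pose d := cross (B - A) (C - A).
have val1 := conic_form_circum (B 0 1 - C 0 1) (C 0 1 - A 0 1) (A 0 1 - B 0 1) cM.
have val2 := conic_form_circum (B 0 0 - C 0 0) (C 0 0 - A 0 0) (A 0 0 - B 0 0) cM.
have z1 : B 0 1 - C 0 1 + (C 0 1 - A 0 1) + (A 0 1 - B 0 1) = 0 by ring.
have z2 : B 0 0 - C 0 0 + (C 0 0 - A 0 0) + (A 0 0 - B 0 0) = 0 by ring.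
rewrite z1 in val1; rewrite z2 in val2.
rewrite (rectangularP sM).
have e : d ^+ 2 * (M i0 i0 + M i1 i1)
  = - 2 * (l * dot (B - A) (C - A) + m * dot (C - B) (A - B) + n * dot (A - C) (B - C)).
  transitivity (2 * (l * ((C 0 1 - A 0 1) * (A 0 1 - B 0 1))
      + m * ((A 0 1 - B 0 1) * (B 0 1 - C 0 1)) + n * ((B 0 1 - C 0 1) * (C 0 1 - A 0 1)))
    + 2 * (l * ((C 0 0 - A 0 0) * (A 0 0 - B 0 0))
      + m * ((A 0 0 - B 0 0) * (B 0 0 - C 0 0)) + n * ((B 0 0 - C 0 0) * (C 0 0 - A 0 0)))).
    by rewrite -val1 -val2 !conic_form_cart // !mxE /d /cross !mxE; ring.
  by rewrite !dotE !mxE; ring.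
split=> h.
  by move/eqP: e; rewrite h mulr0 eq_sym mulf_eq0 oppr_eq0 pnatr_eq0 /= => /eqP.
by move/eqP: e; rewrite h mulr0 mulf_eq0 sqrf_eq0 (negPf d0) /= => /eqP.
Qed.

End Conic.

(** * The generalized orthocenter of the Nagel point *)

Section NagelPoint.
Variable R : rcfType.
Implicit Types (A B C D E F O P Q S X Y : 'rV[R]_2) (M N : 'M[R]_(2 + 1)).
Implicit Types (l m n x y z : R).

(** The sides of the anticomplementary triangle are [y + z = 0], [z + x = 0], [x + y = 0], which
    positive coordinates avoid. *)
Lemma generic_bary A B C x y z : triangle A B C -> 0 < x -> 0 < y -> 0 < z ->
  generic A B C (bary A B C x y z).
Proof.
move=> tri x0 y0 z0.
have s0 : x + y + z != 0 by rewrite lt0r_neq0 ?addr_gt0.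
have tri' := tri; rewrite triangleC in tri'.
have tri'' := tri'; rewrite triangleC in tri''.
have s0' : y + z + x != 0 by rewrite lt0r_neq0 ?addr_gt0.
have s0'' : z + x + y != 0 by rewrite lt0r_neq0 ?addr_gt0.
have one (a b c : R) : a + b + c = 1 -> a + b + c != 0 by move=> ->; apply: oner_neq0.
have h1 : -1 + 1 + 1 != 0 :> R by apply: one; ring.
have h2 : 1 + -1 + 1 != 0 :> R by apply: one; ring.
have h3 : 1 + 1 + -1 != 0 :> R by apply: one; ring.
have vA : B + C - A = bary A B C (-1) 1 1.
  by rewrite bary_split //; apply: rV2P; rewrite !mxE; field.
have vB : C + A - B = bary A B C 1 (-1) 1.
  by rewrite bary_split //; apply: rV2P; rewrite !mxE; field.
have vC : A + B - C = bary A B C 1 1 (-1).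
  by rewrite bary_split //; apply: rV2P; rewrite !mxE; field.
rewrite /generic /off_sides vA vB vC !on_line_bary //.
rewrite on_side_bary // {1}baryC on_side_bary // {1}baryC {1}baryC on_side_bary //.
by apply/andP; split; apply/and3P; split; apply: lt0r_neq0; lra.
Qed.

(** With [t = x * y + y * z + z * x], the Mittenpunkt coordinates add up to [2 * t] and
    [(y + z) * (z + x) = t + z ^+ 2], which leaves the factor [t - z ^+ 2]. *)
Lemma mittenpunkt_parallel A B C x y z u v w : triangle A B C ->
  0 < x -> 0 < y -> 0 < z -> u + v + w = 1 ->
  (cross (bary A B C 0 y z
      - bary A B C (x * (y + z)) (y * (z + x)) (z * (x + y)))
    (bary A B C u v w - A) == 0)
  = (y * (x * y + y * z + z * x - z ^+ 2) * w
      == z * (x * y + y * z + z * x - y ^+ 2) * v).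
Proof.
move=> tri x0 y0 z0 s1.
have h0 : 0 + y + z != 0 by rewrite add0r lt0r_neq0 ?addr_gt0.
have h1 : x * (y + z) + y * (z + x) + z * (x + y) != 0.
  by rewrite lt0r_neq0 ?addr_gt0 ?mulr_gt0 ?addr_gt0.
by rewrite parallel_bary // ?s1 ?oner_eq0 //; congr (_ * _ == _ * _); ring.
Qed.

Lemma cevian_trace A B C x y z : triangle A B C -> 0 < x -> 0 < y -> 0 < z ->
  on_line B C (bary A B C 0 y z) && on_line A (bary A B C x y z) (bary A B C 0 y z).
Proof.
move=> tri x0 y0 z0.
have s0 : x + y + z != 0 by rewrite lt0r_neq0 ?addr_gt0.
have h0 : 0 + y + z != 0 by rewrite add0r lt0r_neq0 ?addr_gt0.
by rewrite on_side_bary // on_cevian_bary // mulrC !eqxx.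
Qed.

Lemma on_lineC A X Y : on_line A X Y = on_line A Y X.
Proof. by rewrite /on_line -oppr_eq0; congr (_ == 0); rewrite /cross; ring. Qed.

(** The point with coordinates [x / (s - x ^+ 2)] and cyclically, with denominators cleared so that
    they may vanish. *)
Definition gen_orthocenter_nagel A B C x y z : 'rV[R]_2 :=
  let s := x * y + y * z + z * x in
  bary A B C (x * (s - y ^+ 2) * (s - z ^+ 2)) (y * (s - z ^+ 2) * (s - x ^+ 2))
    (z * (s - x ^+ 2) * (s - y ^+ 2)).

(** The sum factors as [4 * s * (x * y * z)], so the point is never at infinity. *)
Lemma nagel_sum_gt0 x y z s : 0 < x -> 0 < y -> 0 < z ->
  s = x * y + y * z + z * x ->
  0 < x * (s - y ^+ 2) * (s - z ^+ 2) + y * (s - z ^+ 2) * (s - x ^+ 2)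
    + z * (s - x ^+ 2) * (s - y ^+ 2).
Proof.
move=> x0 y0 z0 {s}->.
set s := x * y + y * z + z * x.
have -> : x * (s - y ^+ 2) * (s - z ^+ 2) + y * (s - z ^+ 2) * (s - x ^+ 2)
    + z * (s - x ^+ 2) * (s - y ^+ 2) = 4 * s * (x * y * z).
  by rewrite /s; ring.
by rewrite !mulr_gt0 ?addr_gt0 ?mulr_gt0 ?ltr0n.
Qed.

Lemma meet_of_parallels_nagel A B C x y z : triangle A B C ->
  0 < x -> 0 < y -> 0 < z ->
  meet_of_parallels A B C (bary A B C (x * (y + z)) (y * (z + x)) (z * (x + y)))
    (bary A B C 0 y z) (bary A B C x 0 z) (bary A B C x y 0)
    (gen_orthocenter_nagel A B C x y z).
Proof.
move=> tri x0 y0 z0.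
have tri' := tri; rewrite triangleC in tri'.
have tri'' := tri'; rewrite triangleC in tri''.
have xn0 := lt0r_neq0 x0; have yn0 := lt0r_neq0 y0; have zn0 := lt0r_neq0 z0.
have h1 : x * (y + z) + y * (z + x) + z * (x + y) != 0.
  by rewrite lt0r_neq0 ?addr_gt0 ?mulr_gt0 ?addr_gt0.
have hD : 0 + y + z != 0 by rewrite add0r lt0r_neq0 ?addr_gt0.
have hE : x + 0 + z != 0 by rewrite addr0 lt0r_neq0 ?addr_gt0.
have hF : x + y + 0 != 0 by rewrite addr0 lt0r_neq0 ?addr_gt0.
have neq p q r p' q' r' : p + q + r != 0 -> p' + q' + r' != 0 ->
    p * (p' + q' + r') != p' * (p + q + r) \/ q * (p' + q' + r') != q' * (p + q + r)
      \/ r * (p' + q' + r') != r' * (p + q + r) ->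
    bary A B C p q r != bary A B C p' q' r'.
  move=> p0 p0' H; apply/eqP => /(bary_inj tri p0 p0') [e1 [e2 e3]].
  by case: H => [|[|]]; rewrite ?e1 ?e2 ?e3 eqxx.
split.
- by apply: neq => //; left; rewrite mul0r !mulf_neq0 // -[y + z]add0r addrA.
- apply: neq => //; right; left; rewrite mul0r !mulf_neq0 //.
  by rewrite lt0r_neq0 ?addr_gt0.
- apply: neq => //; right; right; rewrite mul0r !mulf_neq0 //.
  by rewrite lt0r_neq0 ?addr_gt0.
move=> S; have [u [v [w [s1 ->]]]] := baryP S tri.
have s1' : v + w + u = 1 by rewrite -s1; ring.
have s1'' : w + u + v = 1 by rewrite -s1; ring.
rewrite mittenpunkt_parallel //.
rewrite ![in X in [&& _, X & _]](baryC A) mittenpunkt_parallel //.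
rewrite ![in X in [&& _, _ & X]](baryC A) ![in X in [&& _, _ & X]](baryC B).
rewrite mittenpunkt_parallel //.
rewrite /gen_orthocenter_nagel; set s := x * y + y * z + z * x => /=.
have sum0 := lt0r_neq0 (nagel_sum_gt0 x0 y0 z0 (erefl s)).
have -> : y * z + z * x + x * y = s by rewrite /s; ring.
have -> : z * x + x * y + y * z = s by rewrite /s; ring.
move: (s - x ^+ 2) (s - y ^+ 2) (s - z ^+ 2) sum0 => a b c sum0.
have n1 : u + v + w != 0 by rewrite s1 oner_eq0.
apply/and3P/eqP => [[/eqP eA /eqP eB /eqP eC]|/(bary_inj tri n1 sum0)].
  rewrite -(bary_scale A B C u v w sum0).
  rewrite -(bary_scale A B C (x * b * c) _ _ n1).
  (* Multiplied by [a], [b], [c], the three equations relate exactly the products occurring in the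
     scaled coordinates. *)
  have aA := congr1 ( *%R a) eA; have bB := congr1 ( *%R b) eB.
  have cC := congr1 ( *%R c) eC.
  by congr bary; lra.
rewrite s1 !mulr1; move: sum0; move: (_ + _ + _) => T T0 [e1 [e2 e3]].
by split; apply/eqP/(mulIf T0); rewrite -!mulrA ?e1 ?e2 ?e3; ring.
Qed.

Lemma excontact_cycle A B C D E F : triangle A B C ->
  [/\ excontact A B C D, excontact B C A E & excontact C A B F]
  <-> [/\ D = bary A B C 0 (ravi B C A) (ravi C A B),
        E = bary A B C (ravi A B C) 0 (ravi C A B)
      & F = bary A B C (ravi A B C) (ravi B C A) 0].
Proof.
move=> tri.
have tri' := tri; rewrite triangleC in tri'.
have tri'' := tri'; rewrite triangleC in tri''.
have hD := excontactP D tri; have hE := excontactP E tri'.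
have hF := excontactP F tri''.
rewrite -(baryC A) in hE; rewrite -(baryC B) -(baryC A) in hF.
by split=> -[/hD ? /hE ? /hF ?]; split.
Qed.

End NagelPoint.

(** * The Feuerbach hyperbola and the points on it *)

Theorem corollary2p9 (R : rcfType) (A B C I H P : 'rV[R]_2)
    (ABC : triangle A B C) (scal : scalene A B C)
    (hI : incenter A B C I) (hH : orthocenter A B C H)
    (hP : gergonne A B C P) :
  exists (P' H' : 'rV[R]_2) (CP : 'M[R]_(2 + 1)),
    let Q := complement A B C P' in
    let Q' := complement A B C P in
    [/\ isotomic A B C P P' /\ unique_conic_through [:: A; B; C; P; Q] CP,
        [/\ Q = I,
            feuerbach_hyperbola A B C CP,
            all (on_conic CP) [:: A; B; C; H; I]
          & ~~ right_angled A B C ->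
            unique_conic_through [:: A; B; C; H; I] CP],
        nagel A B C P' /\ on_conic CP P',
        mittenpunkt A B C Q' /\ on_conic CP Q'
      & [/\ gen_orthocenter A B C P' H',
            on_conic CP H'
          & forall D E F : 'rV[R]_2,
              excontact A B C D -> excontact B C A E -> excontact C A B F ->
              meet_of_parallels A B C Q' D E F H']].
Proof.
have hIP : I = bary A B C (ravi B C A + ravi C A B) (ravi C A B + ravi A B C)
    (ravi A B C + ravi B C A).
  by have [r [D [E [F inc]]]] := hI; exact: incircle_center inc.
have hPP := gergonne_bary ABC hP.
have exc D E F := excontact_cycle D E F ABC.
have := orthocenter_bary ABC hH.
have BCA := ABC; rewrite triangleC in BCA.
have CAB := BCA; rewrite triangleC in CAB.
have rect := fun l m n M => @circumconic_rectangular R A B C l m n M ABC.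
move: rect; rewrite /right_angled.
have [x0 y0 z0] := ravi_pos ABC.
have [xy yz zx] : [/\ ravi A B C != ravi B C A, ravi B C A != ravi C A B
    & ravi C A B != ravi A B C].
  move: scal => /and3P[]; rewrite -(ravi_dist A B C) -(ravi_dist B C A).
  rewrite -(ravi_dist C A B) => h1 h2 h3; split.
  - by apply: contraNneq h2 => ->; rewrite addrC.
  - by apply: contraNneq h3 => ->; rewrite addrC.
  - by apply: contraNneq h1 => ->; rewrite addrC.
have dotA := dot_ravi A B C; have dotB := dot_ravi B C A; have dotC := dot_ravi C A B.
move: x0 y0 z0 xy yz zx hIP hPP exc dotA dotB dotC.
set x := ravi A B C; set y := ravi B C A; set z := ravi C A B.
move: x y z => x y z x0 y0 z0 xy yz zx hIP hPP exc dotA dotB dotC.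
rewrite dotA dotB dotC => rect /= [hS hHP].
move: hS hHP rect.
set Sa := x ^+ 2 + _ + _ - _; set Sb := y ^+ 2 + _ + _ - _; set Sc := z ^+ 2 + _ + _ - _.
move=> hS hHP rect.
pose l := x * (y + z) * (z - y); pose m := y * (z + x) * (x - z).
pose n := z * (x + y) * (y - x).
have xn0 := lt0r_neq0 x0; have yn0 := lt0r_neq0 y0; have zn0 := lt0r_neq0 z0.
have yzn0 : y + z != 0 by rewrite lt0r_neq0 ?addr_gt0.
have zxn0 : z + x != 0 by rewrite lt0r_neq0 ?addr_gt0.
have xyn0 : x + y != 0 by rewrite lt0r_neq0 ?addr_gt0.
have l0 : l != 0 by rewrite !mulf_neq0 // subr_eq0 eq_sym.
have m0 : m != 0 by rewrite !mulf_neq0 // subr_eq0 eq_sym.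
have n0 : n != 0 by rewrite !mulf_neq0 // subr_eq0 eq_sym.
have [M [conM cM dM]] := circumconic_ex ABC l0 m0 n0.
have sN : x + y + z != 0 by rewrite lt0r_neq0 ?addr_gt0.
have sP : y * z + z * x + x * y != 0.
  by rewrite lt0r_neq0 ?addr_gt0 ?mulr_gt0.
have sI : y + z + (z + x) + (x + y) != 0 by rewrite lt0r_neq0 ?addr_gt0.
have sM : x * (y + z) + y * (z + x) + z * (x + y) != 0.
  by rewrite lt0r_neq0 ?addr_gt0 ?mulr_gt0 ?addr_gt0.
have sH := nagel_sum_gt0 x0 y0 z0 (erefl _).
have hQ : complement A B C (bary A B C x y z) = I.
  by rewrite complement_bary // hIP.
have hQ' : complement A B C P = bary A B C (x * (y + z)) (y * (z + x)) (z * (x + y)).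
  by rewrite hPP complement_bary //; congr bary; ring.
have hPinv : P = bary A B C x^-1 y^-1 z^-1.
  rewrite hPP -(bary_scale A B C x^-1 y^-1 z^-1 (k := x * y * z)) ?mulf_neq0 //.
  by congr bary; field.
have sPinv : x^-1 + y^-1 + z^-1 != 0.
  by rewrite lt0r_neq0 ?addr_gt0 ?invr_gt0.
have onABC : all (on_conic M) [:: A; B; C].
  have s1 : 1 + 0 + 0 != 0 :> R by rewrite !addr0 oner_eq0.
  have s2 : 0 + 1 + 0 != 0 :> R by rewrite addr0 add0r oner_eq0.
  have s3 : 0 + 0 + 1 != 0 :> R by rewrite !add0r oner_eq0.
  apply/and4P; split=> //.
  - rewrite [X in on_conic _ X](bary_vertex A B C).
    by rewrite (on_circumconic cM) //; apply/eqP; ring.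
  - rewrite [X in on_conic _ X](bary_vertex B C A) -(baryC A).
    by rewrite (on_circumconic cM) //; apply/eqP; ring.
  rewrite [X in on_conic _ X](bary_vertex C A B) baryC.
  by rewrite (on_circumconic cM) //; apply/eqP; ring.
have onP : on_conic M P.
  by rewrite hPP (on_circumconic cM) //; apply/eqP; rewrite /l /m /n; ring.
have onI : on_conic M I.
  by rewrite hIP (on_circumconic cM) //; apply/eqP; rewrite /l /m /n; ring.
have onH : on_conic M H.
  rewrite hHP (on_circumconic cM) //; apply/eqP.
  by rewrite /l /m /n /Sa /Sb /Sc; ring.
have [symM _] := conM.
exists (bary A B C x y z), (gen_orthocenter_nagel A B C x y z), M.
cbv zeta; rewrite hQ hQ'.
have /exc[exD exE exF] : [/\ bary A B C 0 y z = bary A B C 0 y z,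
  bary A B C x 0 z = bary A B C x 0 z & bary A B C x y 0 = bary A B C x y 0] by split.
have hmeet := meet_of_parallels_nagel ABC x0 y0 z0.
(* Both directions are needed: [isoP] presents the Nagel point as [P'], while [isoP'] makes the
   Mittenpunkt the base point of the parallels defining [H']. *)
have isoP' : isotomic A B C (bary A B C x y z) P.
  exists x, y, z; rewrite xn0 yn0 zn0 hPinv.
  by split=> //; apply: barycentric_bary.
have isoP : isotomic A B C P (bary A B C x y z).
  exists x^-1, y^-1, z^-1; rewrite !invr_eq0 xn0 yn0 zn0 hPinv !invrK.
  by split=> //; apply: barycentric_bary.
have coefI N l' m' n' : on_conic N I -> circumconic A B C l' m' n' N ->
    l' * ((z + x) * (x + y)) + m' * ((x + y) * (y + z)) + n' * ((y + z) * (z + x)) = 0.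
  by rewrite hIP => oN cN; move: oN; rewrite (on_circumconic cN) // => /eqP.
have uniqP N : conic N -> all (on_conic N) [:: A; B; C; P; I] -> same_conic M N.
  move=> conN /and5P[oA oB oC oP /andP[oI _]].
  have coefP N' l' m' n' : on_conic N' P -> circumconic A B C l' m' n' N' ->
      l' * x + m' * y + n' * z = 0.
    rewrite hPP => + cN'; rewrite (on_circumconic cN') // => /eqP e.
    apply: (mulfI (mulf_neq0 (mulf_neq0 xn0 yn0) zn0)); rewrite mulr0 -e; ring.
  apply: (circumconic_unique (u := (x, y, z))
    (v := ((z + x) * (x + y), (x + y) * (y + z), (y + z) * (z + x))) ABC cM l0) => //=.
  - exact: coefP cM.
  - exact: coefI cM.
  (* The first entry of the cross product of the two conditions; it is nonzero because [y != z]. *)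
  - have -> : y * ((y + z) * (z + x)) - z * ((x + y) * (y + z)) = (y + z) * x * (y - z).
      by ring.
    by rewrite !mulf_neq0 // subr_eq0.
  - by rewrite oA oB oC.
  by move=> l' m' n' cN; split; [exact: coefP cN|exact: coefI cN].
have trM : l * Sa + m * Sb + n * Sc = 0 by rewrite /l /m /n /Sa /Sb /Sc; ring.
(* Stating rectangularity as a linear condition serves both uniqueness claims: among rectangular
   hyperbolas through [I], and among conics through [H] and [I]. *)
have uniqH N : conic N -> all (on_conic N) [:: A; B; C; I] ->
    (forall l' m' n', circumconic A B C l' m' n' N -> l' * Sa + m' * Sb + n' * Sc = 0) ->
    same_conic M N.
  move=> conN /and5P[oA oB oC oI _] trN.
  apply: (circumconic_unique (u := (Sa, Sb, Sc))
    (v := ((z + x) * (x + y), (x + y) * (y + z), (y + z) * (z + x))) ABC cM l0) => //=.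
  - exact: coefI cM.
  - have -> : Sb * ((y + z) * (z + x)) - Sc * ((x + y) * (y + z))
        = 2 * (y + z) * x * (y - z) * (x + y + z) by rewrite /Sb /Sc; ring.
    by rewrite !mulf_neq0 ?pnatr_eq0 // subr_eq0.
  - by rewrite oA oB oC.
  by move=> l' m' n' cN; split; [exact: trN|exact: coefI cN].
have /and4P[onA onB onC _] := onABC.
have trD := cevian_trace ABC x0 y0 z0.
have trE := cevian_trace BCA y0 z0 x0; rewrite -!(baryC A) in trE.
have trF := cevian_trace CAB z0 x0 y0; rewrite -!(baryC B) -!(baryC A) in trF.
split.
- split=> //; split=> //.
  by rewrite /= onA onB onC onP onI.
- split=> //.
  + exists I; split=> //; first by split=> //; apply/(rect _ _ _ M symM cM).
      by rewrite /= onA onB onC onI.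
    move=> N [conN _ rN] oN; apply: uniqH => // l' m' n' cN.
    by have [symN _] := conN; apply/(rect _ _ _ N symN cN).
  + by rewrite onA onB onC onH onI.
  rewrite !negb_or => /and3P[Sa0 Sb0 Sc0]; split=> //.
    by rewrite /= onA onB onC onH onI.
  move=> N conN /and5P[oA oB oC oH /andP[oI _]].
  apply: uniqH => //; first by rewrite /= oA oB oC oI.
  (* At [H] the equation of the conic is [Sa * Sb * Sc] times the rectangularity condition; without
     right angles this factor cancels. *)
  move=> l' m' n' cN; move: oH; rewrite hHP (on_circumconic cN) // => /eqP e.
  by apply: (mulfI (mulf_neq0 (mulf_neq0 Sa0 Sb0) Sc0)); rewrite mulr0 -e; ring.
- split; last by rewrite (on_circumconic cM) //; apply/eqP; rewrite /l /m /n; ring.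
  exists (bary A B C 0 y z), (bary A B C x 0 z), (bary A B C x y 0); split=> //.
  by move: trD trE trF; rewrite !(on_lineC _ (bary A B C x y z));
    move=> /andP[_ ?] /andP[_ ?] /andP[_ ?].
- split; last by rewrite (on_circumconic cM) //; apply/eqP; rewrite /l /m /n; ring.
  by exists P.
split.
- split; first exact: generic_bary.
  by exists P, (bary A B C 0 y z), (bary A B C x 0 z), (bary A B C x y 0); rewrite hQ'.
- rewrite (on_circumconic cM) ?lt0r_neq0 //; apply/eqP; rewrite /l /m /n; ring.
by move=> D E F eD eE eF; have /exc[-> -> ->] : [/\ excontact A B C D,
  excontact B C A E & excontact C A B F].
Qed.
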